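(* Each nonzero prime ideal of a Dedekind semidomain is maximal. In other words, the Krull dimension of a Dedekind semidomain is at most $1$.
   Context: A semiring is $(S,+,\cdot,0,1)$ where $(S,+,0)$ and $(S,\cdot,1)$ are commutative monoids, $1\neq 0$, multiplication distributes over addition, and $a\cdot 0=0$ for all $a$. A semidomain is a semiring $S$ in which $ab=ac$ with $a\neq 0$ implies $b=c$. Its semifield of fractions $K=F(S)$ is the localization of $S$ at $S-\{0\}$. An ideal of $S$ is a nonempty subset closed under addition and under multiplication by elements of $S$. A prime ideal is a proper ideal $\mathfrak{p}$ such that $ab\in\mathfrak{p}$ implies $a\in\mathfrak{p}$ or $b\in\mathfrak{p}$. The Krull dimension of $S$ is the supremum of the lengths of chains of prime ideals in $S$. A fractional ideal of $S$ is a nonempty subset $A\subseteq K$ closed under addition and under multiplication by elements of $S$ such that $dA\subseteq S$ for some nonzero $d\in S$. The product of fractional ideals $A,B$ is $AB=\{\sum_{i=1}^n a_ib_i: a_i\in A, b_i\in B\}$, and $A$ is invertible if $AB=S$ for some fractional ideal $B$. A Dedekind semidomain is a semidomain in which each nonzero fractional ideal is invertible. *)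

(* Defs.v *)
From HB Require Import structures.
From mathcomp Require Import all_boot all_order all_algebra.
From mathcomp Require Import generic_quotient.
From mathcomp Require Import classical_sets reals constructive_ereal ereal.

Set Implicit Arguments.
Unset Strict Implicit.
Unset Printing Implicit Defensive.

Import Order.TTheory GRing.Theory Num.Theory.
Local Open Scope ring_scope.

HB.mixin Record isSemidomain S of GRing.ComNzSemiRing S := {
  semidomain_mulfI : forall a b c : S, a != 0 -> a * b = a * c -> b = c
}.

#[short(type="semidomainType")]
HB.structure Definition Semidomain := {S of isSemidomain S & GRing.ComNzSemiRing S}.

Lemma semidomain_mulf_neq0 (S : semidomainType) (a b : S) :
  a != 0 -> b != 0 -> a * b != 0.
Proof.
move=> a0 b0; apply/eqP=> ab0; case/eqP: b0.
by apply: (semidomain_mulfI a _ _ a0); rewrite ab0 mulr0.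
Qed.

(* The library's {fraction R} requires an integral domain, hence opposites, so
   the localization of a semidomain at its nonzero elements is built here: pairs
   (n, d) with d != 0, modulo (n, d) ~ (n', d') iff n * d' = d * n'. *)
Module SemiFrac.
Section SemiFrac.
Local Open Scope quotient_scope.
Variable S : semidomainType.

Record ratio := MkRatio { frac :> S * S; _ : frac.2 != 0 }.
HB.instance Definition _ := [isSub for frac].
HB.instance Definition _ := [Choice of ratio by <:].

Implicit Types x y z : ratio.
Local Notation num x := (frac x).1.
Local Notation den x := (frac x).2.

Lemma den_neq0 x : den x != 0. Proof. by case: x. Qed.
Lemma den_mul_neq0 x y : den x * den y != 0.
Proof. exact: semidomain_mulf_neq0 (den_neq0 x) (den_neq0 y). Qed.

Definition equivf x y := num x * den y == den x * num y.

Lemma equivf_refl : reflexive equivf.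
Proof. by move=> x; rewrite /equivf mulrC. Qed.

Lemma equivf_sym : symmetric equivf.
Proof. by move=> x y; rewrite /equivf eq_sym; congr (_ == _); rewrite mulrC. Qed.

Lemma equivf_trans : transitive equivf.
Proof.
move=> y x z; rewrite /equivf => /eqP xy /eqP yz; apply/eqP.
apply: (semidomain_mulfI _ _ _ (den_neq0 y)).
by rewrite mulrA [den y * _]mulrC xy -mulrA yz mulrCA.
Qed.

Canonical equivf_equiv := EquivRel equivf equivf_refl equivf_sym equivf_trans.

Definition type := {eq_quot equivf}.
HB.instance Definition _ : EqQuotient _ equivf type := EqQuotient.on type.
HB.instance Definition _ := Choice.on type.

Lemma equivf_def x y : x == y %[mod type] = (num x * den y == den x * num y).
Proof. by rewrite eqmodE. Qed.

Lemma equivf_r x : num x * den (repr (\pi_type x)) = den x * num (repr (\pi_type x)).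
Proof.
by apply/eqP; rewrite -equivf_def reprK.
Qed.

Lemma equivf_l x : num (repr (\pi_type x)) * den x = den (repr (\pi_type x)) * num x.
Proof. by apply/eqP; rewrite -equivf_def reprK. Qed.

Definition embf (a : S) : ratio := @MkRatio (a, 1) (oner_neq0 S).
Definition addf x y : ratio :=
  @MkRatio (num x * den y + num y * den x, den x * den y) (den_mul_neq0 x y).
Definition mulf x y : ratio :=
  @MkRatio (num x * num y, den x * den y) (den_mul_neq0 x y).

Definition tofrac := lift_embed type embf.
Canonical tofrac_pi_morph := PiEmbed tofrac.

Definition add := lift_op2 type addf.
Lemma pi_add : {morph \pi : x y / addf x y >-> add x y}.
Proof.
move=> x y; unlock add; apply/eqmodP; rewrite /= /equivf /=; apply/eqP.
rewrite mulrDr mulrDl.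
symmetry; rewrite (AC (2*2) (3*1*2*4)) (AC (2*2) (3*2*1*4))/=.
by rewrite !equivf_l (ACl ((2*3)*(1*4))) (ACl ((2*3)*(4*1)))/=.
Qed.
Canonical pi_add_morph := PiMorph2 pi_add.

Definition mul := lift_op2 type mulf.
Lemma pi_mul : {morph \pi : x y / mulf x y >-> mul x y}.
Proof.
move=> x y; unlock mul; apply/eqmodP; rewrite /= /equivf /=; apply/eqP.
by rewrite mulrACA !equivf_r mulrACA.
Qed.
Canonical pi_mul_morph := PiMorph2 pi_mul.

Lemma addA : associative add.
Proof.
elim/quotW=> x; elim/quotW=> y; elim/quotW=> z; rewrite !piE.
congr (\pi); apply: val_inj; rewrite /= !mulrDl.
by rewrite !mulrA !addrA ![_ * _ * den x]mulrAC.
Qed.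

Lemma addC : commutative add.
Proof.
elim/quotW=> x; elim/quotW=> y; rewrite !piE.
by congr (\pi); apply: val_inj; rewrite /= addrC [den x * _]mulrC.
Qed.

Lemma add0 : left_id (tofrac 0) add.
Proof.
elim/quotW=> x; rewrite !piE; congr (\pi); apply: val_inj => /=.
by rewrite mul0r mul1r mulr1 add0r -surjective_pairing.
Qed.

HB.instance Definition _ := GRing.isNmodule.Build type addA addC add0.

Lemma mulA : associative mul.
Proof.
elim/quotW=> x; elim/quotW=> y; elim/quotW=> z; rewrite !piE.
by congr (\pi); apply: val_inj; rewrite /= !mulrA.
Qed.

Lemma mulC : commutative mul.
Proof.
elim/quotW=> x; elim/quotW=> y; rewrite !piE.
by congr (\pi); apply: val_inj; rewrite /= mulrC [den x * _]mulrC.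
Qed.

Lemma mul1 : left_id (tofrac 1) mul.
Proof.
elim/quotW=> x; rewrite !piE; congr (\pi); apply: val_inj => /=.
by rewrite !mul1r -surjective_pairing.
Qed.

Lemma mulDl : left_distributive mul add.
Proof.
elim/quotW=> x; elim/quotW=> y; elim/quotW=> z; apply/eqP.
rewrite !piE /equivf /=; apply/eqP.
rewrite !(mulrDr, mulrDl) (AC (3*(2*2)) (4*2*7*((1*3)*(6*5))))/=.
by rewrite [X in _ + X](AC (3*(2*2)) (4*6*7*((1*3)*(2*5))))/=.
Qed.

Lemma mul0 : left_zero (tofrac 0) mul.
Proof.
elim/quotW=> x; apply/eqP; rewrite !piE /equivf /=.
by rewrite !mul0r mulr0.
Qed.

Lemma nonzero1 : tofrac 1 != tofrac 0.
Proof. by rewrite piE /equivf /= !mulr1 mulr0 oner_eq0. Qed.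

HB.instance Definition _ :=
  GRing.Nmodule_isComNzSemiRing.Build type mulA mulC mul1 mulDl mul0 nonzero1.

End SemiFrac.
End SemiFrac.
HB.export SemiFrac.

Arguments SemiFrac.type S%_type.
Notation "{ 'semifraction' S }" := (SemiFrac.type S)
  (format "{ 'semifraction'  S }") : type_scope.

Section SemiFracTheory.
Variable S : semidomainType.
Local Open Scope quotient_scope.
Local Notation tofrac := (@SemiFrac.tofrac S).

Lemma semifrac_nmod_morphism : nmod_morphism tofrac.
Proof.
split=> [//|a b]; unlock SemiFrac.tofrac; rewrite -[RHS]SemiFrac.pi_add.
by congr (\pi); apply: val_inj; rewrite /= !mulr1.
Qed.
HB.instance Definition _ :=
  GRing.isNmodMorphism.Build S {semifraction S} tofrac semifrac_nmod_morphism.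

Lemma semifrac_monoid_morphism : monoid_morphism tofrac.
Proof.
split=> [//|a b]; unlock SemiFrac.tofrac; rewrite -[RHS]SemiFrac.pi_mul.
by congr (\pi); apply: val_inj; rewrite /= !mulr1.
Qed.
HB.instance Definition _ :=
  GRing.isMonoidMorphism.Build S {semifraction S} tofrac semifrac_monoid_morphism.

Lemma semifrac_inj : injective tofrac.
Proof.
move=> a b; unlock SemiFrac.tofrac => /eqmodP.
by rewrite /= /SemiFrac.equivf /= mulr1 mul1r => /eqP.
Qed.

Lemma semifrac_unit (d : S) : d != 0 ->
  exists y : {semifraction S}, tofrac d * y = 1.
Proof.
move=> d0; exists (\pi_(SemiFrac.type S) (@SemiFrac.MkRatio S (1, d) d0)); apply/eqP.
rewrite -[X in _ == X]/(tofrac 1) -[_ * _]/(SemiFrac.mul _ _) !piE /SemiFrac.equivf /=.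
by rewrite mulr1 mul1r.
Qed.

Lemma semifracP (x : {semifraction S}) :
  exists n d : S, d != 0 /\ tofrac d * x = tofrac n.
Proof.
elim/quotW: x => -[[n d] /= d0]; exists n, d; split=> //; apply/eqP.
rewrite -[_ * _]/(SemiFrac.mul _ _) !piE /SemiFrac.equivf /=.
by rewrite mulr1 mul1r.
Qed.

Lemma semifrac_mulV (x : {semifraction S}) : x != 0 -> exists y, x * y = 1.
Proof.
have [n [d [d0 xE]]] := semifracP x => x0.
have n0 : n != 0.
  apply/eqP=> n0; case/eqP: x0; have [y dy] := semifrac_unit d0.
  by rewrite -[x]mul1r -dy mulrAC xE n0 rmorph0 mul0r.
have [y ny] := semifrac_unit n0; exists (tofrac d * y).
by rewrite mulrCA mulrA xE ny.
Qed.

End SemiFracTheory.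

Local Open Scope classical_set_scope.

Section Ideals.
Variable S : comNzSemiRingType.
Implicit Types I m p : set S.

Definition semi_ideal I : Prop :=
  [/\ I !=set0,
      forall a b, I a -> I b -> I (a + b)
    & forall s a, I a -> I (s * a)].

Definition semi_prime_ideal p : Prop :=
  [/\ semi_ideal p, p != setT & forall a b, p (a * b) -> p a \/ p b].

Definition semi_maximal_ideal m : Prop :=
  [/\ semi_ideal m, m != setT
    & forall I, semi_ideal I -> m `<=` I -> I = m \/ I = setT].

Definition prime_chain (n : nat) (p : 'I_n.+1 -> set S) : Prop :=
  (forall i, semi_prime_ideal (p i)) /\
  (forall i j : 'I_n.+1, (i < j)%N -> p i `<` p j).

End Ideals.

(* The real field R only serves to provide the extended reals in which the
   supremum of the (natural number) lengths is taken. *)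
Definition krull_dim (R : realType) (S : comNzSemiRingType) : \bar R :=
  ereal_sup [set (n%:R)%:E | n in
    [set n : nat | exists p : 'I_n.+1 -> set S, prime_chain p]].

Section FractionalIdeals.
Variable S : semidomainType.
Local Notation K := {semifraction S}.
Local Notation tofrac := (@SemiFrac.tofrac S).
Implicit Types A B : set K.

Definition fractional_ideal A : Prop :=
  [/\ A !=set0,
      forall x y, A x -> A y -> A (x + y),
      forall (s : S) x, A x -> A (tofrac s * x)
    & exists2 d : S, d != 0 & forall x, A x -> range tofrac (tofrac d * x)].

Definition fractional_mul A B : set K :=
  [set x | exists (n : nat) (a b : 'I_n -> K),
    [/\ forall i, A (a i), forall i, B (b i) & x = \sum_(i < n) a i * b i]].

Definition fractional_invertible A : Prop :=
  exists2 B, fractional_ideal B & fractional_mul A B = range tofrac.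

End FractionalIdeals.

Definition dedekind_semidomain (S : semidomainType) : Prop :=
  forall A : set {semifraction S},
    fractional_ideal A -> A != [set 0] -> fractional_invertible A.

(* Main.v *)
(** If [p] is a prime ideal properly contained in an ideal [I] of a Dedekind
    semidomain, then [I^-1 p] lies in [p]: for [x] in [I] outside [p] we have
    [x (I^-1 p) <= p]. Multiplying by [I] gives [p = I I^-1 p <= I p], and
    cancelling the invertible ideal [p] yields [1 \in I]. *)
Require Import Defs.
From mathcomp Require Import all_boot all_order all_algebra.
From mathcomp Require Import classical_sets reals constructive_ereal ereal.
From mathcomp Require Import boolp.

Local Open Scope ring_scope.
Local Open Scope classical_set_scope.

Import GRing.Theory Num.Theory.

Section SemiIdealTheory.
Variable S : comNzSemiRingType.
Implicit Types I p : set S.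

Lemma semi_ideal0 I : semi_ideal I -> I 0.
Proof. by case=> -[a Ia] _ IM; rewrite -(mul0r a); apply: IM. Qed.

Lemma semi_ideal_sum I n (f : 'I_n -> S) :
  semi_ideal I -> (forall i, I (f i)) -> I (\sum_(i < n) f i).
Proof.
move=> idI If; have [_ ID _] := idI.
by apply: (big_ind I) => // ; apply: semi_ideal0.
Qed.

Lemma semi_ideal1 I : semi_ideal I -> I 1 -> I = setT.
Proof.
move=> [_ _ IM] I1; apply/seteqP; split=> // x _.
by rewrite -(mulr1 x); apply: IM.
Qed.

Lemma semi_ideal_neq0 I : semi_ideal I -> I != [set 0] -> exists2 a, I a & a != 0.
Proof.
move=> idI /eqP I0; apply: contrapT => noa; apply: I0.
apply/seteqP; split=> [x Ix|_ ->]; last exact: semi_ideal0.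
by apply: contrapT => x0; apply: noa; exists x => //; apply/eqP.
Qed.

End SemiIdealTheory.

Section DedekindTheory.
Variable S : semidomainType.
Hypothesis dedS : dedekind_semidomain S.
Local Notation K := {semifraction S}.
Local Notation tofrac := (@SemiFrac.tofrac S).
Implicit Types I p : set S.

Lemma fractional_ideal_image I : semi_ideal I -> fractional_ideal (tofrac @` I).
Proof.
move=> [[a Ia] ID IM]; split.
- by exists (tofrac a), a.
- by move=> _ _ [x Ix <-] [y Iy <-]; exists (x + y); rewrite ?rmorphD//; apply: ID.
- by move=> s _ [x Ix <-]; exists (s * x); rewrite ?rmorphM//; apply: IM.
- by exists 1; [exact: oner_neq0 | move=> _ [x Ix <-]; exists x; rewrite ?rmorph1 ?mul1r].
Qed.

Lemma fractional_mul_mem (A B : set K) x y :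
  A x -> B y -> fractional_mul A B (x * y).
Proof.
by move=> Ax By; exists 1%N, (fun=> x), (fun=> y); split=> //; rewrite big_ord1.
Qed.

(** Invertibility in coordinates: if [B] is inverse to the image of [I], expanding 1 in the product
    gives the finite sum, and each [b i], lying in [B], multiplies [I] into [S]. *)
Lemma dedekind_dual_basis I : semi_ideal I -> I != [set 0] ->
  exists n (a : 'I_n -> S) (b : 'I_n -> K),
    [/\ forall i, I (a i),
        forall i x, I x -> range tofrac (tofrac x * b i)
      & \sum_(i < n) tofrac (a i) * b i = 1].
Proof.
move=> idI I0; have [B _ IB] : fractional_invertible (tofrac @` I).
  apply: dedS; first exact: fractional_ideal_image.
  (* A nonzero element of [I] stays nonzero in [K], since [tofrac] is injective. *)
  have [a Ia a0] := semi_ideal_neq0 _ _ idI I0.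
  apply/eqP=> I0'; have : (tofrac @` I) (tofrac a) by exists a.
  by rewrite I0' /= -(rmorph0 tofrac) => /semifrac_inj /eqP; rewrite (negPf a0).
have [n [a [b [Ia Bb ab]]]] : fractional_mul (tofrac @` I) B 1.
  by rewrite IB; exists 1; rewrite ?rmorph1.
have /choice[c cP] : forall i, exists x, I x /\ tofrac x = a i.
  by move=> i; have [x Ix xa] := Ia i; exists x.
exists n, c, b; split=> [i|i x Ix|].
- by have [] := cP i.
- by rewrite -IB; apply: fractional_mul_mem => //; exists x.
- by rewrite ab; apply: eq_bigr => i _; have [_ ->] := cP i.
Qed.

Lemma dedekind_prime_maximal p :
  semi_prime_ideal p -> p != [set 0] -> semi_maximal_ideal p.
Proof.
move=> [idp pT prp] p0; split=> // I idI pI.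
have [Ip|/existsNP[x /not_implyP[Ix npx]]] := pselect (I `<=` p).
  by left; apply/seteqP.
right; apply: semi_ideal1 => //.
have I0 : I != [set 0].
  apply/eqP=> I0; apply: npx; move: Ix; rewrite I0 => ->; exact: semi_ideal0.
have [m [a [c [pa pc ac1]]]] := dedekind_dual_basis _ idp p0.
have [n [y [b [Iy Ib yb1]]]] := dedekind_dual_basis _ idI I0.
have pM := let: And3 _ _ M := idp in M.
(* The product of [a i] and [b k] lies in [S] because [a i] is in [I]. Times [x] it equals [t * a i]
   with [t = x * b k] in [S], hence lies in [p]; as [x] is not in [p], primality puts the product
   itself in [p]. *)
have /choice[j jP] : forall ik : 'I_m * 'I_n, exists s,
    p s /\ tofrac s = tofrac (a ik.1) * b ik.2.
  move=> [i k] /=; have [s _ sE] := Ib k _ (pI _ (pa i)).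
  exists s; split=> //; have [t _ tE] := Ib k _ Ix.
  suff: p (x * s) by case/prp.
  suff -> : x * s = t * a i by apply: pM.
  by apply: semifrac_inj; rewrite !rmorphM /= sE tE mulrA mulrAC.
(* Each [c i] multiplies [p] into [S], so it can be applied to [j (i, k)]; this is the cancellation
   of [p]. *)
have /choice[u uP] : forall ik : 'I_m * 'I_n, exists s,
    tofrac s = tofrac (j ik) * c ik.1.
  by move=> ik; have [s _ sE] := pc ik.1 _ (jP ik).1; exists s.
(* Multiply the two expansions of 1, for [p] and for [I], and regroup: the coefficients [u] are in
   [S] and the [y k] in [I], so 1 is in [I]. *)
have -> : 1 = \sum_(i < m) \sum_(k < n) u (i, k) * y k.
  apply: semifrac_inj; rewrite rmorph1 rmorph_sum -ac1.
  apply: eq_bigr => i _; rewrite rmorph_sum -[LHS]mulr1 -yb1 mulr_sumr.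
  apply: eq_bigr => k _; rewrite rmorphM /= uP (jP (i, k)).2 /=.
  by rewrite [_ * b k * _]mulrAC -[RHS]mulrA [b k * _]mulrC.
have [_ _ IM] := idI.
by do 2!apply: semi_ideal_sum => // ?; apply: IM.
Qed.

(** In a chain of length at least 2, the second prime strictly contains the first, so it is nonzero
    and hence maximal; but the third is proper and strictly larger. *)
Lemma dedekind_prime_chain_le1 n (p : 'I_n.+1 -> set S) :
  prime_chain p -> (n <= 1)%N.
Proof.
move=> [prp ltp]; rewrite leqNgt; apply/negP => n2.
pose i0 : 'I_n.+1 := inord 0; pose i1 : 'I_n.+1 := inord 1.
pose i2 : 'I_n.+1 := inord 2.
have [_ n10] : p i0 `<` p i1 by apply: ltp; rewrite !inordK // ltnW.
have [le12 n21] : p i1 `<` p i2 by apply: ltp; rewrite !inordK // ltnW.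
have [id0 _ _] := prp i0; have [id2 p2T _] := prp i2.
have p1_neq0 : p i1 != [set 0].
  by apply/eqP=> p1; apply: n10; rewrite p1 => _ ->; exact: semi_ideal0.
have [_ _ max1] := dedekind_prime_maximal _ (prp i1) p1_neq0.
have [p21|p2T'] := max1 _ id2 le12; first by apply: n21; rewrite p21.
by rewrite p2T' eqxx in p2T.
Qed.

End DedekindTheory.

Theorem theorem3p21 (R : realType) (S : semidomainType)
    (hS : dedekind_semidomain S) :
  (forall p : set S,
      semi_prime_ideal p -> p != [set 0] -> semi_maximal_ideal p) /\
  (krull_dim R S <= 1)%E.
Proof.
split; first exact: dedekind_prime_maximal.
apply: ge_ereal_sup => _ [n [p chp] <-].
by rewrite lee_fin (ler_nat R n 1) (dedekind_prime_chain_le1 _ hS _ _ chp).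
Qed.
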